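(* Let $\mu=\mu_1\otimes\dots\otimes\mu_d$ be a product probability measure on $\mathbb{R}^d$ and assume that for each $1\le i\le d$ the measure $\mu_i$ is even and admits a second moment. Let $f,g:\mathbb{R}^d\to\mathbb{R}$ be functions in $L^2(\mu)$ all of whose first and second partial derivatives are integrable with respect to $\mu$. Assume that for each $1\le i\le d$ the signs of $\partial_{i,i}f(x)$ and $\partial_{i,i}g(x)$ are constant on $\mathbb{R}^d$ and equal. Assume moreover that one of the functions $f,g$ is unconditional. Then $$\mathrm{Cov}_\mu(f,g)\ge 0.$$
   Context: $\mathrm{Cov}_\mu(f,g)=\int (f-\int f\,d\mu)(g-\int g\,d\mu)\,d\mu$. A measure on $\mathbb{R}$ is even if it is invariant under $x\mapsto -x$. A function $f:\mathbb{R}^d\to\mathbb{R}$ is unconditional if $f(x_1,\dots,x_d)=f(\varepsilon_1x_1,\dots,\varepsilon_dx_d)$ for all $x\in\mathbb{R}^d$ and all signs $(\varepsilon_1,\dots,\varepsilon_d)\in\{-1,1\}^d$. ''The signs of $u$ and $v$ are constant and equal'' means: either $u\ge0$ and $v\ge0$ everywhere, or $u\le0$ and $v\le0$ everywhere; the common sign may depend on $i$. *)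

(* Defs.v *)
From mathcomp Require Import all_boot all_order all_algebra.
From mathcomp Require Import all_classical all_reals all_analysis.

Set Implicit Arguments.
Unset Strict Implicit.
Unset Printing Implicit Defensive.
Import Order.TTheory GRing.Theory Num.Theory.
Import numFieldNormedType.Exports.

Local Open Scope classical_set_scope.
Local Open Scope ring_scope.

(* R^d is [d.-tuple R], whose measurable structure is the product of the Borel
   sigma-algebras of the factors, that is, the Borel sigma-algebra of R^d. *)

Definition even_measure (R : realType) (m : set R -> \bar R) : Prop :=
  forall A : set R, measurable A -> m (-%R @^-1` A) = m A.

(* Finite measures that agree on measurable boxes are equal, so this property
   determines [mu] from the family [m]. *)
Definition is_product_measure (R : realType) (d : nat)
    (mu : set (d.-tuple R) -> \bar R) (m : 'I_d -> set R -> \bar R) : Prop :=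
  forall A : 'I_d -> set R, (forall i, measurable (A i)) ->
    mu [set x | forall i, A i (tnth x i)] = (\prod_(i < d) m i (A i))%E.

Definition set_coord (R : realType) (d : nat) (x : d.-tuple R) (i : 'I_d)
    (t : R) : d.-tuple R :=
  [tuple if j == i then t else tnth x j | j < d].

Definition partial_derivable (R : realType) (d : nat) (i : 'I_d)
    (f : d.-tuple R -> R) : Prop :=
  forall x, derivable (fun t : R => f (set_coord x i t)) (tnth x i) 1.

Definition partial (R : realType) (d : nat) (i : 'I_d)
    (f : d.-tuple R -> R) (x : d.-tuple R) : R :=
  derive1 (fun t : R => f (set_coord x i t)) (tnth x i).

Definition integrable_partials (R : realType) (d : nat)
    (mu : {measure set (d.-tuple R) -> \bar R}) (f : d.-tuple R -> R) : Prop :=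
  (forall i, partial_derivable i f /\
     mu.-integrable setT (EFin \o partial i f)) /\
  (forall i j, partial_derivable i (partial j f) /\
     mu.-integrable setT (EFin \o partial i (partial j f))).

Definition unconditional (R : realType) (d : nat) (f : d.-tuple R -> R) : Prop :=
  forall (eps : 'I_d -> R), (forall i, eps i = 1 \/ eps i = -1) ->
    forall x, f x = f [tuple eps i * tnth x i | i < d].

Definition same_constant_sign (T : Type) (R : realType) (u v : T -> R) : Prop :=
  (forall x, 0 <= u x /\ 0 <= v x) \/ (forall x, u x <= 0 /\ v x <= 0).

(* Main.v *)
Require Import Defs.
From mathcomp Require Import all_boot all_order all_algebra.
From mathcomp Require Import all_classical all_reals all_analysis.
From mathcomp Require Import measurable_realfun lra.

(** Say that [f] is the unconditional function. Let [x] and [y] be independent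
    with law [mu], that is, work under the measure [mu \x mu]. For a set [S] of
    coordinates let [mix S] take its coordinates in [S] from [y] and the others
    from [x], and consider

      [c S = \int f x * g (mix S)].

    For [S] empty this is the integral of [f * g]; for [S] full it is the
    product of the integrals of [f] and [g], by Fubini. So the covariance is
    nonnegative as soon as [c] decreases when one coordinate [i] is added to
    [S] ([cross_swap_ge]), and then [cross_telescope] adds the coordinates one
    at a time.

    For one step let [h] be the integrand of [c S - c (S + i)]. Two
    transformations preserve [mu \x mu]: exchanging the [i]-th coordinates of
    [x] and [y], and changing the sign of the [i]-th coordinate in both copies
    (this uses that [m i] is even). Hence the integral of [h] is a quarter of
    the integral of the sum of [h] over the four compositions. Let [u] and [v]
    be the [i]-th coordinates of [x] and [y], let [a] be the slice of [f] through
    [x] and [b] the slice of [g] through [mix S], both in the direction [i].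
    Since [a] is even, that sum is

      [(a u - a v) * ((b u + b (- u)) - (b v + b (- v)))],

    and it is nonnegative at every point: for a convex function [b] of one real
    variable, [b t + b (- t)] increases with [`|t|]; for a concave one it
    decreases; the same holds for [a t], which is half of [a t + a (- t)]; and
    [a] and [b] are both convex or both concave ([slices_comonotone]).

    The invariance of [mu \x mu] is checked on products of two boxes, which
    determine a finite measure on pairs ([measure_pair_unique]). *)

Set Implicit Arguments.
Unset Strict Implicit.
Unset Printing Implicit Defensive.

Import Order.TTheory GRing.Theory Num.Theory.
Import numFieldNormedType.Exports.
Local Open Scope classical_set_scope.
Local Open Scope ring_scope.

(** * Even parts of convex functions of one variable *)

Section even_part.
Context {R : realType}.
Implicit Types a b h : R -> R.

Lemma derive1_mvt h (u v : R) : (forall t, derivable h t 1) -> u <= v ->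
  exists2 c, u <= c <= v & h v - h u = derive1 h c * (v - u).
Proof.
move=> dh uv.
have [t _||c cuv ->] := @MVT_segment R h (derive1 h) u v uv.
- by apply: DeriveDef => //; rewrite derive1E.
- apply: derivable_within_continuous => t _; exact: dh.
- by exists c => //; move: cuv; rewrite in_itv.
Qed.

Definition convex_with_derivatives h := [/\ forall t, derivable h t 1,
  forall t, derivable (derive1 h) t 1 & forall t, 0 <= derive1 (derive1 h) t].

Definition evenized h t := h t + h (- t).

(** Comparing two points therefore reduces to nonnegative ones. *)
Lemma evenized_norm h t : evenized h `|t| = evenized h t.
Proof. by rewrite /evenized; case: (ger0P t); rewrite // opprK addrC. Qed.

(** For [0 <= u <= v] the increment of [h] from [u] to [v] is a slope taken to
    the right of [u], the increment from [- v] to [- u] a slope taken to the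
    left of [- u]; the first slope is at least the second because the
    derivative increases. *)
Lemma evenized_le h u v : convex_with_derivatives h -> `|u| <= `|v| ->
  evenized h u <= evenized h v.
Proof.
move=> [dh ddh h2] uv; rewrite -(evenized_norm h u) -(evenized_norm h v).
move: uv (normr_ge0 u); move: `|u| `|v| => {}u {}v uv u0.
have [c /andP[uc _] hc] := derive1_mvt dh uv.
have vu : - v <= - u by rewrite lerN2.
have [c' /andP[_ uc'] hc'] := derive1_mvt dh vu.
have c'c : c' <= c by lra.
have [t _ ht] := derive1_mvt ddh c'c.
have : 0 <= (derive1 h c - derive1 h c') * (v - u).
  by rewrite ht !mulr_ge0// ?h2// subr_ge0.
by rewrite /evenized; nra.
Qed.

Lemma convex_with_derivativesN h : (forall t, derivable h t 1) ->
  (forall t, derivable (derive1 h) t 1) ->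
  (forall t, derive1 (derive1 h) t <= 0) ->
  convex_with_derivatives (\- h).
Proof.
move=> dh ddh h2.
have E (k : R -> R) : (forall t, derivable k t 1) ->
    derive1 (\- k) = \- derive1 k.
  by move=> dk; apply/funext => t; rewrite /= !derive1E; apply: deriveN.
split=> [t|t|t].
- exact: derivableN.
- by rewrite E//; exact: derivableN.
- by rewrite !E// oppr_ge0.
Qed.

Lemma evenizedN h t : evenized (\- h) t = - evenized h t.
Proof. by rewrite /evenized opprD. Qed.

(** In the concave case both differences change sign, and their product does
    not. *)
Lemma evenized_comonotone a b (u v : R) :
    (forall t, derivable a t 1) -> (forall t, derivable (derive1 a) t 1) ->
    (forall t, derivable b t 1) -> (forall t, derivable (derive1 b) t 1) ->
    same_constant_sign (derive1 (derive1 a)) (derive1 (derive1 b)) ->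
  0 <= (evenized a u - evenized a v) * (evenized b u - evenized b v).
Proof.
move=> da dda db ddb ab.
wlog uv : u v / `|u| <= `|v|.
  move=> H; have [|/ltW] := leP `|u| `|v|; first exact: H.
  by move=> /H; rewrite -mulrNN !opprB.
case: ab => ab.
  have := @evenized_le a u v; have := @evenized_le b u v.
  have ca : convex_with_derivatives a by split=> // t; have [] := ab t.
  have cb : convex_with_derivatives b by split=> // t; have [] := ab t.
  move=> /(_ cb uv) ? /(_ ca uv) ?.
  by rewrite mulr_le0// subr_le0.
have := @evenized_le (\- a) u v; have := @evenized_le (\- b) u v.
have ca : convex_with_derivatives (\- a).
  by apply: convex_with_derivativesN => // t; have [] := ab t.
have cb : convex_with_derivatives (\- b).
  by apply: convex_with_derivativesN => // t; have [] := ab t.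
move=> /(_ cb uv) + /(_ ca uv); rewrite !evenizedN !lerN2 => ? ?.
by rewrite mulr_ge0// subr_ge0.
Qed.

End even_part.

(** * Integrals along measure-preserving maps *)

Section transfer.
Context d1 d2 (X : measurableType d1) (Y : measurableType d2) (R : realType).
Variables (mu : {measure set X -> \bar R}) (nu : {measure set Y -> \bar R}).
Variables (phi : X -> Y) (mphi : measurable_fun setT phi).
Hypothesis muphi : forall A, measurable A -> mu (phi @^-1` A) = nu A.
Local Open Scope ereal_scope.

Lemma ge0_integral_preserving (h : Y -> \bar R) : measurable_fun [set: Y] h ->
  (forall y, 0 <= h y) -> \int[mu]_x h (phi x) = \int[nu]_y h y.
Proof.
move=> mh h0; rewrite -(ge0_integral_pushforward mphi mu measurableT mh)//.
by apply: eq_measure_integral => A mA _; rewrite -muphi.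
Qed.

Lemma integrable_preserving (h : Y -> \bar R) :
  nu.-integrable setT h -> mu.-integrable setT (h \o phi).
Proof.
move=> /integrableP[mh ih]; apply/integrableP; split.
  exact: measurableT_comp.
rewrite (@ge0_integral_preserving (abse \o h))//.
- exact: measurableT_comp.
- by move=> y; exact: abse_ge0.
Qed.

Lemma integral_preserving (h : Y -> \bar R) : nu.-integrable setT h ->
  \int[mu]_x h (phi x) = \int[nu]_y h y.
Proof.
move=> ih; have mh := measurable_int _ ih.
rewrite -(integral_pushforward mphi mh (integrable_preserving ih) measurableT).
by apply: eq_measure_integral => A mA _; rewrite -muphi.
Qed.

Lemma Lfun2_preserving (h : Y -> R) :
  h \in Lfun nu 2%:E -> h \o phi \in Lfun mu 2%:E.
Proof.
move=> /[!inE] /andP[/[!inE]/= mh]; rewrite /finite_norm unlock => nh.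
apply/andP; rewrite !inE /=; split; first exact: measurableT_comp.
rewrite /finite_norm unlock /=.
rewrite (@ge0_integral_preserving (fun y => (`|h y| `^ 2)%:E))//.
apply/measurable_EFinP.
apply: (@measurableT_comp _ _ _ _ _ _ (fun x : R => x `^ 2)%R) => //.
exact: measurableT_comp.
Qed.

End transfer.

(** * Pairs of boxes, and mixing two points *)

Section boxes.
Context {R : realType} {d : nat}.
Notation T := (d.-tuple R).
Implicit Types (A B : 'I_d -> set R) (S : 'I_d -> bool) (z : T * T).

Definition box A : set T := [set x | forall i, A i (tnth x i)].

Lemma measurable_box A : (forall i, measurable (A i)) -> measurable (box A).
Proof.
move=> mA.
rewrite (_ : box A = \bigcap_(i in setT) ((@tnth _ _)^~ i @^-1` A i)); last first.
  by apply/seteqP; split=> x /= xA i; [move=> _; exact: xA|exact: (xA i I)].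
apply: fin_bigcap_measurable => // i _.
by rewrite -[X in measurable X]setTI; exact: measurable_tnth.
Qed.

Lemma boxI A A' : box A `&` box A' = box (fun i => A i `&` A' i).
Proof.
apply/seteqP; split=> x /=; first by move=> [xA xA'] i; split.
by move=> xA; split=> i; have [] := xA i.
Qed.

Definition box_pairs : set (set (T * T)) :=
  [set X | exists A B, [/\ forall i, measurable (A i),
     forall i, measurable (B i) & X = box A `*` box B]].

Lemma box_pairs_setI : setI_closed box_pairs.
Proof.
move=> _ _ [A [B [mA mB ->]]] [A' [B' [mA' mB' ->]]].
exists (fun i => A i `&` A' i), (fun i => B i `&` B' i); split.
- by move=> i; exact: measurableI.
- by move=> i; exact: measurableI.
- by rewrite -!boxI setXI.
Qed.

(** It is enough that the identity is measurable from the sigma-algebra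
    generated by pairs of boxes, and maps into products are measurable
    coordinate by coordinate. *)
Lemma box_pairs_generate : measurable = <<s box_pairs >>.
Proof.
have measurable_coord i (D : set R) : measurable D ->
    box (fun j => if j == i then D else setT) = (@tnth _ _)^~ i @^-1` D.
  move=> mD; apply/seteqP; split => x /=; first by move/(_ i); rewrite eqxx.
  by move=> xD j; case: eqP => [->|].
have boxT : box (fun=> setT) = setT by apply/seteqP; split.
apply/seteqP; split; last first.
  apply: smallest_sub; first exact: sigma_algebra_measurable.
  by move=> _ [A [B [mA mB ->]]]; apply: measurableX; exact: measurable_box.
have mid : measurable_fun [set: g_sigma_algebraType box_pairs]
    (id : g_sigma_algebraType box_pairs -> T * T).
  apply/measurable_fun_pairP; split; apply/measurable_fun_tnthP => i _ D mD;
    rewrite setTI; apply: sub_sigma_algebra.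
  - exists (fun j => if j == i then D else setT), (fun=> setT).
    split=> [j|//|]; first by case: ifP.
    by rewrite measurable_coord// boxT; apply/seteqP; split=> z //= [].
  - exists (fun=> setT), (fun j => if j == i then D else setT).
    split=> [//|j|]; first by case: ifP.
    by rewrite measurable_coord// boxT; apply/seteqP; split=> z //= [].
by move=> X mX; have := mid measurableT X mX; rewrite setTI.
Qed.

Lemma measure_pair_unique (P Q : {measure set (T * T) -> \bar R}) :
    (P setT < +oo)%E ->
    (forall A B, (forall i, measurable (A i)) -> (forall i, measurable (B i)) ->
      P (box A `*` box B) = Q (box A `*` box B)) ->
  forall X, measurable X -> P X = Q X.
Proof.
move=> Poo PQ X mX.
apply: (measure_unique box_pairs (fun=> setT)) => //.
- exact: box_pairs_generate.
- exact: box_pairs_setI.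
- move=> _; exists (fun=> setT), (fun=> setT); split=> //.
  by apply/seteqP; split.
- by rewrite bigcup_const.
- by move=> _ [A [B [mA mB ->]]]; exact: PQ.
Qed.

(** A set of coordinates is a boolean function, so that exchanging coordinates
    acts on it by symmetric difference ([mix_swap]). *)
Definition mix S z : T := [tuple if S i then tnth z.2 i else tnth z.1 i | i < d].

Definition swap_coords S z := (mix S z, mix (fun i => ~~ S i) z).

Definition flip_coord (i : 'I_d) (x : T) := set_coord x i (- tnth x i).

Definition flip_pair i z := (flip_coord i z.1, flip_coord i z.2).

Lemma mix_swap S S' z :
  mix S (swap_coords S' z) = mix (fun i => S i (+) S' i) z.
Proof.
by apply: eq_from_tnth => i; rewrite !tnth_mktuple; case: (S i); case: (S' i).
Qed.

Lemma mix_flip S i z :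
  mix S (flip_pair i z) = flip_coord i (mix S z).
Proof.
apply: eq_from_tnth => j; rewrite !tnth_mktuple; case: eqP => [->|//].
by case: (S i).
Qed.

Lemma measurable_mix S : measurable_fun setT (mix S).
Proof.
apply/measurable_fun_tnthP => i.
have -> : (@tnth _ _)^~ i \o mix S =
    (@tnth _ _)^~ i \o (if S i then snd else fst).
  by apply/funext => z /=; rewrite tnth_mktuple; case: (S i).
apply: measurableT_comp; first exact: measurable_tnth.
by case: (S i).
Qed.

Lemma measurable_flip i : measurable_fun setT (flip_coord i).
Proof.
apply/measurable_fun_tnthP => j.
have -> : (@tnth _ _)^~ j \o flip_coord i =
    (if j == i then -%R else id) \o (@tnth _ _)^~ j.
  by apply/funext => x /=; rewrite tnth_mktuple; case: eqP => [->|].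
apply: measurableT_comp; last exact: measurable_tnth.
by case: ifP.
Qed.

End boxes.

(** * Invariance of the law of two independent copies *)

Section invariance.
Context {R : realType} {d : nat}.
Notation T := (d.-tuple R).
Variables (m : 'I_d -> probability R R) (mu : probability T R).
Hypothesis hmu : is_product_measure mu (fun i => m i).
Local Notation P := (mu \x mu)%E.

Lemma box_pair_measure (A B : 'I_d -> set R) :
    (forall i, measurable (A i)) -> (forall i, measurable (B i)) ->
  P (box A `*` box B) = (\prod_(i < d) (m i (A i) * m i (B i)))%E.
Proof.
move=> mA mB; rewrite product_measure1E; [|exact: measurable_box..].
by rewrite big_split; congr (_ * _)%E; exact: hmu.
Qed.

(** The maps of interest send pairs of boxes to pairs of boxes and only permute
    or reflect their sides, so the factor of each coordinate can be compared
    separately. *)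
Lemma invariant_of_boxes (phi : T * T -> T * T) :
    measurable_fun setT phi ->
    (forall A B, (forall i, measurable (A i)) -> (forall i, measurable (B i)) ->
      exists A' B', [/\ forall i, measurable (A' i), forall i, measurable (B' i),
        phi @^-1` (box A `*` box B) = box A' `*` box B' &
        forall i, (m i (A' i) * m i (B' i) = m i (A i) * m i (B i))%E]) ->
  forall X, measurable X -> P (phi @^-1` X) = P X.
Proof.
move=> mphi phiP X mX; apply/esym.
apply: (@measure_pair_unique _ _ P (pushforward P phi)) => //.
- by apply: (@le_lt_trans _ _ 1%E); [exact: probability_le1|exact: ltry].
- move=> A B mA mB; have [A' [B' [mA' mB' phiAB e]]] := phiP A B mA mB.
  rewrite [RHS](_ : _ = P (box A' `*` box B')); last by rewrite -phiAB.
  apply: (etrans (box_pair_measure mA mB)).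
  apply: etrans (esym (box_pair_measure mA' mB')).
  by apply: eq_bigr => i _; rewrite e.
Qed.

Lemma measurable_swap_coords (S : 'I_d -> bool) :
  measurable_fun setT (@swap_coords R d S).
Proof. by apply: measurable_fun_pair; exact: measurable_mix. Qed.

Lemma swap_coords_invariant (S : 'I_d -> bool) X :
  measurable X -> P (swap_coords S @^-1` X) = P X.
Proof.
apply: invariant_of_boxes; first exact: measurable_swap_coords.
move=> A B mA mB.
exists (fun i => if S i then B i else A i), (fun i => if S i then A i else B i).
split=> [i|i||i]; try by case: ifP.
- apply/seteqP; split=> z /= [zA zB]; split=> i;
    move: (zA i) (zB i); rewrite !tnth_mktuple; by case: (S i).
- by case: ifP => // _; rewrite muleC.
Qed.

Lemma measurable_flip_pair i : measurable_fun setT (@flip_pair R d i).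
Proof.
by apply: measurable_fun_pair;
  apply: measurableT_comp => //; exact: measurable_flip.
Qed.

Hypothesis heven : forall i, even_measure (m i).

Lemma flip_pair_invariant i X :
  measurable X -> P (flip_pair i @^-1` X) = P X.
Proof.
apply: invariant_of_boxes; first exact: measurable_flip_pair.
have mN (D : set R) : measurable D -> measurable (-%R @^-1` D).
  by move=> mD; rewrite -[X in measurable X]setTI; exact: oppr_measurable.
move=> A B mA mB.
pose refl (C : 'I_d -> set R) j := if j == i then -%R @^-1` C j else C j.
exists (refl A), (refl B); rewrite /refl; split=> [j|j||j].
- by case: ifP => // _; exact: mN.
- by case: ifP => // _; exact: mN.
- apply/seteqP; split=> z /= [zA zB]; split=> j;
    move: (zA j) (zB j); rewrite !tnth_mktuple; by case: eqP => [->|].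
- by case: ifP => // _; rewrite !heven.
Qed.

Lemma fst_measure (D : set T) : measurable D -> P (fst @^-1` D) = mu D.
Proof.
move=> mD; rewrite (_ : fst @^-1` D = D `*` setT).
  rewrite product_measure1E// [X in (_ * X)%E](_ : _ = 1%E) ?mule1//.
  exact: probability_setT.
by apply/seteqP; split=> z //= [].
Qed.

Lemma snd_measure (D : set T) : measurable D -> P (snd @^-1` D) = mu D.
Proof.
move=> mD; rewrite (_ : snd @^-1` D = setT `*` D).
  rewrite product_measure1E// [X in (X * _)%E](_ : _ = 1%E) ?mul1e//.
  exact: probability_setT.
by apply/seteqP; split=> z //= [].
Qed.

(** [mix S] is the first component of the measure-preserving
    [swap_coords S]. *)
Lemma mix_measure S (D : set T) : measurable D -> P (mix S @^-1` D) = mu D.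
Proof.
move=> mD; rewrite -fst_measure// -[RHS](swap_coords_invariant S)//.
by rewrite -[X in measurable X]setTI; exact: measurable_fst.
Qed.

End invariance.

Section symmetrization.
Context dZ (Z : measurableType dZ) (R : realType).
Variable P : {measure set Z -> \bar R}.
Variables s r : Z -> Z.
Hypotheses (ms : measurable_fun setT s) (mr : measurable_fun setT r).
Hypothesis Ps : forall A, measurable A -> P (s @^-1` A) = P A.
Hypothesis Pr : forall A, measurable A -> P (r @^-1` A) = P A.

(** All four summands have the same integral; [h] itself need not have a
    sign. *)
Lemma integral_ge0_of_symmetrized (h : Z -> R) :
    P.-integrable setT (EFin \o h) ->
    (forall z, 0 <= (h z + h (s z)) + (h (r z) + h (s (r z)))) ->
  (0 <= \int[P]_z (h z)%:E)%E.
Proof.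
move=> ih h0.
have his := integrable_preserving ms Ps ih.
have ihs : P.-integrable setT (EFin \o (fun z => h z + h (s z))).
  exact: (integrableD measurableT ih his).
have ihsr := integrable_preserving mr Pr ihs.
have : (0 <= \int[P]_z ((h z + h (s z)) + (h (r z) + h (s (r z))))%:E)%E.
  by apply: integral_ge0 => z _; rewrite lee_fin.
rewrite (integralD_EFin measurableT ihs ihsr).
rewrite (integral_preserving mr Pr ihs) (integralD_EFin measurableT ih his).
rewrite (integral_preserving ms Ps ih).
move: (integrable_fin_num measurableT ih) => /=.
case: (integral _ _ _) => [e| |] //= _.
by rewrite -!EFinD !lee_fin => e0; lra.
Qed.

End symmetrization.

(** * Slices in one coordinate direction *)

Section slices.
Context {R : realType} {d : nat}.
Notation T := (d.-tuple R).
Implicit Types (f g : T -> R) (x w : T) (i : 'I_d).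

Lemma set_coord_set x i s t : set_coord (set_coord x i s) i t = set_coord x i t.
Proof. by apply: eq_from_tnth => j; rewrite !tnth_mktuple; case: eqP. Qed.

Lemma set_coord_id x i : set_coord x i (tnth x i) = x.
Proof. by apply: eq_from_tnth => j; rewrite !tnth_mktuple; case: eqP => [->|]. Qed.

Lemma tnth_set_coord x i t : tnth (set_coord x i t) i = t.
Proof. by rewrite tnth_mktuple eqxx. Qed.

Lemma slice_derivable f x i t : partial_derivable i f ->
  derivable (fun s => f (set_coord x i s)) t 1.
Proof.
move=> /(_ (set_coord x i t)); rewrite tnth_set_coord.
by under [X in derivable X]eq_fun do rewrite set_coord_set.
Qed.

Lemma slice_derive1 f x i :
  derive1 (fun t => f (set_coord x i t)) = fun t => partial i f (set_coord x i t).
Proof.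
apply/funext => t; rewrite /partial tnth_set_coord.
by under [X in _ = derive1 X _]eq_fun do rewrite set_coord_set.
Qed.

(** The base points [x] and [w] are unrelated: the sign of the second
    derivatives is the same on the whole space. This is what allows [f] and [g]
    to be compared at different points. *)
Lemma slices_comonotone f g i x w (u v : R) :
    partial_derivable i f -> partial_derivable i (partial i f) ->
    partial_derivable i g -> partial_derivable i (partial i g) ->
    same_constant_sign (partial i (partial i f)) (partial i (partial i g)) ->
  let a t := f (set_coord x i t) in let b t := g (set_coord w i t) in
  0 <= (evenized a u - evenized a v) * (evenized b u - evenized b v).
Proof.
move=> df ddf dg ddg fg /=; apply: evenized_comonotone.
- by move=> t; exact: slice_derivable.
- by move=> t; rewrite slice_derive1; exact: slice_derivable.
- by move=> t; exact: slice_derivable.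
- by move=> t; rewrite slice_derive1; exact: slice_derivable.
- rewrite !slice_derive1.
  by case: fg => fg; [left|right] => t; have [? _] := fg (set_coord x i t);
    have [_ ?] := fg (set_coord w i t).
Qed.

Lemma unconditional_flip f i x : unconditional f -> f (flip_coord i x) = f x.
Proof.
move=> uf; rewrite [RHS](uf (fun j => if j == i then -1 else 1)).
  congr f; apply: eq_from_tnth => j; rewrite !tnth_mktuple.
  by case: eqP => [->|]; rewrite ?mulN1r ?mul1r.
by move=> j; case: ifP => _; [right|left].
Qed.

End slices.

(** * Replacing coordinates one at a time *)

Section replacement.
Context {R : realType} {d : nat}.
Notation T := (d.-tuple R).
Variables (m : 'I_d -> probability R R) (mu : probability T R) (f g : T -> R).
Hypothesis hmu : is_product_measure mu (fun i => m i).
Hypothesis heven : forall i, even_measure (m i).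
Hypotheses (f2 : f \in Lfun mu 2%:E) (g2 : g \in Lfun mu 2%:E).
Hypothesis df : forall i,
  partial_derivable i f /\ partial_derivable i (partial i f).
Hypothesis dg : forall i,
  partial_derivable i g /\ partial_derivable i (partial i g).
Hypothesis fg : forall i,
  same_constant_sign (partial i (partial i f)) (partial i (partial i g)).
Hypothesis uf : unconditional f.
Local Notation P := (mu \x mu)%E.

Let cross S (z : T * T) := f z.1 * g (mix S z).

Lemma integrable_cross S : P.-integrable setT (EFin \o cross S).
Proof.
apply/Lfun1_integrable; apply: Lfun2_mul_Lfun1.
- by apply: Lfun2_preserving f2; [exact: measurable_fst|exact: fst_measure].
- apply: Lfun2_preserving g2; first exact: measurable_mix.
  exact: (mix_measure hmu).
Qed.

(** Replacing the coordinate [i] of the argument of [g] by its independent copy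
    can only decrease the integral. Exchanging the two copies of that coordinate
    interchanges [mix S] and [mix S'], and turns [x] into the point where only
    the coordinate [i] has been replaced. *)
Lemma cross_swap_ge (S S' : 'I_d -> bool) i :
    ~~ S i -> (forall j, S' j = S j (+) (j == i)) ->
  (\int[P]_z (cross S' z)%:E <= \int[P]_z (cross S z)%:E)%E.
Proof.
move=> Si S'E.
have iS := integrable_cross S; have iS' := integrable_cross S'.
rewrite -sube_ge0; last first.
  by rewrite (integrable_fin_num measurableT iS').
rewrite -(integralB_EFin measurableT iS iS').
apply: (@integral_ge0_of_symmetrized _ _ _ P (swap_coords (fun j => j == i))
    (flip_pair i) _ _ _ _ (cross S \- cross S')).
- exact: measurable_swap_coords.
- exact: measurable_flip_pair.
- by move=> X mX; exact: (swap_coords_invariant hmu).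
- by move=> X mX; exact: (flip_pair_invariant hmu).
- exact: (integrableB measurableT iS iS').
move=> z /=.
set x := z.1; set w := mix S z; set u := tnth z.1 i; set v := tnth z.2 i.
have S'S : mix (fun j => S j (+) (j == i)) =1 @mix R d S'.
  by move=> z'; apply: eq_from_tnth => j; rewrite !tnth_mktuple S'E.
have SS' : mix (fun j => S' j (+) (j == i)) =1 @mix R d S.
  by move=> z'; apply: eq_from_tnth => j; rewrite !tnth_mktuple S'E addbK.
have wu : tnth w i = u by rewrite tnth_mktuple (negbTE Si).
have w'E : mix S' z = set_coord w i v.
  apply: eq_from_tnth => j; rewrite !tnth_mktuple S'E.
  by case: eqP => [->|]; rewrite ?(negbTE Si)//= addbF.
have x'E : mix (fun j => j == i) z = set_coord x i v.
  by apply: eq_from_tnth => j; rewrite !tnth_mktuple; case: eqP => [->|].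
have [[df1 df2] [dg1 dg2]] := (df i, dg i).
have := slices_comonotone x w u v df1 df2 dg1 dg2 (fg i).
(* The slice of [f] is even, so only [g] is really symmetrized. *)
have aN t : f (set_coord x i (- t)) = f (set_coord x i t).
  by rewrite -(unconditional_flip i (set_coord x i t))// /flip_coord
    tnth_set_coord set_coord_set.
rewrite /evenized !aN -{1 2}/u /cross /= !mix_swap !mix_flip.
rewrite !S'S !SS' !(unconditional_flip _ _ uf).
rewrite x'E w'E -/w -/x /flip_coord set_coord_set tnth_set_coord wu.
have -> : set_coord x i u = x by exact: set_coord_id.
have -> : set_coord w i u = w by rewrite -wu; exact: set_coord_id.
by lra.
Qed.

Lemma cross_telescope k : (k <= d)%N ->
  (\int[P]_z (cross (fun j => (j < k)%N) z)%:E <=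
   \int[P]_z (cross (fun=> false) z)%:E)%E.
Proof.
elim: k => [_|k IH kd].
  by rewrite le_eqVlt (_ : (fun j : 'I_d => _) = fun=> false) ?eqxx//; apply/funext.
apply: le_trans (IH (ltnW kd)).
apply: (@cross_swap_ge _ _ (Ordinal kd)) => /= [|j]; first by rewrite ltnn.
rewrite -val_eqE /= ltnS leq_eqVlt orbC.
by case: ltngtP.
Qed.

Lemma covariance_ge0_unconditional : (0 <= covariance mu f g)%E.
Proof.
have muT : mu setT \is a fin_num by rewrite probability_setT.
have f1 := Lfun_subset12 muT f2; have g1 := Lfun_subset12 muT g2.
have if1 := (Lfun1_integrable _ _).1 f1; have ig1 := (Lfun1_integrable _ _).1 g1.
have fg1 := Lfun2_mul_Lfun1 f2 g2.
rewrite covarianceE// sube_ge0; last first.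
  by rewrite fin_numM// expectation_fin_num.
rewrite unlock.
have /= <- : (\int[P]_z (cross (fun=> false) z)%:E = \int[mu]_x ((f * g) x)%:E)%E.
  have ifg := (Lfun1_integrable _ _).1 fg1.
  rewrite -(integral_preserving measurable_fst (@fst_measure _ _ mu) ifg).
  apply: eq_integral => z _; rewrite /cross; congr (_ * g _)%:E.
  by apply: eq_from_tnth => j; rewrite tnth_mktuple.
apply: le_trans (cross_telescope (leqnn d)).
rewrite (_ : cross _ = fun z => f z.1 * g z.2); last first.
  apply/funext => z; congr (_ * g _).
  by apply: eq_from_tnth => j; rewrite tnth_mktuple ltn_ord.
have ifxg : P.-integrable setT (fun z => (f z.1 * g z.2)%:E).
  apply/Lfun1_integrable; apply: Lfun2_mul_Lfun1.
  - by apply: Lfun2_preserving f2; [exact: measurable_fst|exact: fst_measure].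
  - by apply: Lfun2_preserving g2; [exact: measurable_snd|exact: snd_measure].
rewrite -(integral12_prod_meas1 ifxg).
rewrite le_eqVlt; apply/orP; left; apply/eqP.
rewrite -(fineK (integrable_fin_num measurableT ig1)) -integralZr//.
apply: eq_integral => x _.
rewrite /fubini_F /=.
rewrite fineK ?(integrable_fin_num measurableT ig1)//.
rewrite -(integralZl measurableT ig1).
exact: eq_integral.
Qed.

End replacement.

(** * The covariance inequality *)

Unset Implicit Arguments.

Theorem corollary1p8 (R : realType) (d : nat)
    (m : 'I_d -> probability R R) (mu : probability (d.-tuple R) R)
    (f g : d.-tuple R -> R)
    (hmu : is_product_measure mu (fun i => m i))
    (heven : forall i, even_measure (m i))
    (hmoment : forall i, (m i).-integrable setT (fun x : R => (x ^+ 2)%:E))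
    (hf2 : f \in Lfun mu 2%:E) (hg2 : g \in Lfun mu 2%:E)
    (hf : integrable_partials mu f) (hg : integrable_partials mu g)
    (hsign : forall i, same_constant_sign (partial i (partial i f))
                                          (partial i (partial i g)))
    (huncond : unconditional f \/ unconditional g) :
  (0 <= covariance mu f g)%E.
Proof.
have twice h : integrable_partials mu h ->
    forall i, partial_derivable i h /\ partial_derivable i (partial i h).
  by move=> [h1 h2] i; have [? _] := h1 i; have [? _] := h2 i i.
case: huncond => [uf|ug].
  exact: (covariance_ge0_unconditional hmu heven hf2 hg2 (twice f hf) (twice g hg)).
(* The remaining hypotheses are symmetric in [f] and [g]. *)
rewrite covarianceC.
apply: (covariance_ge0_unconditional hmu heven hg2 hf2 (twice g hg) (twice f hf)).
  by move=> i; case: (hsign i) => fg; [left|right] => x; have [] := fg x.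
exact: ug.
Qed.
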